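(* Suppose that $\Psi$ is bounded below on the closed convex set $\Theta$. Let $\{z^{\nu} = (\theta^{\nu}, r_\nu, s_\nu)\}$ be a (nonterminating) sequence generated by the nonmonotone majorization-minimization (MM) algorithm described in the context. Then the following four statements hold. (a) For every $\nu$, every $(i_1, i_2)\in \mathcal{A}_{1;\varepsilon}(\theta^{\nu})\times \mathcal{A}_{2;\varepsilon}(\theta^{\nu})$ and every $z=(\theta,r,s) \in \mathcal{Z}_{(i_1,i_2)}(\theta^{\nu})$, $$\varphi^{\uparrow}(r_{\nu+1})+\varphi^{\downarrow}(s_{\nu+1})+ \frac{c}{2}\,\|z^{\nu+1} - z^{\nu}\|^2 \le \varphi^{\uparrow}(r) + \varphi^{\downarrow}(s) + \frac{c}{2}\,\|z - z^{\nu}\|^2 .$$ (b) $\lim_{\nu\to\infty}\|z^{\nu+1} - z^{\nu}\|=0$. (c) For any accumulation point $(\theta^{\infty},r_{\infty},s_{\infty})$ of $\{z^{\nu}\}$, if it exists, $\theta^{\infty}$ is a d-stationary point of the problem of minimizing $\Psi$ over $\Theta$. (d) If the set $\{\theta \in \Theta \mid \Psi(\theta) \le \Psi(\theta^{0})\}$ is bounded, then the sequence $\{\theta^{\nu}\}$ is bounded. If in addition the set $\{t\in\mathbb{R} \mid \varphi(t) \le \Psi(\theta^{0})\}$ is bounded, then the sequence $\{(r_{\nu},s_{\nu})\}$ is also bounded.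
   Context: Problem: minimize $\Psi(\theta)=\varphi(\psi(\theta))$ over $\theta\in\Theta$, where $\Theta\subseteq\mathbb{R}^m$ is a (nonempty) closed convex set, $\varphi:\mathbb{R}\to\mathbb{R}$ is convex, and $\psi=g-h$ with $$g(\theta)=\max_{1\le i\le k_1}\psi_{1,i}(\theta),\qquad h(\theta)=\max_{1\le i\le k_2}\psi_{2,i}(\theta),$$ each $\psi_{1,i},\psi_{2,i}:\mathbb{R}^m\to\mathbb{R}$ being convex and (continuously) differentiable. Fix a decomposition $\varphi=\varphi^{\uparrow}+\varphi^{\downarrow}$ with $\varphi^{\uparrow}:\mathbb{R}\to\mathbb{R}$ convex non-decreasing and $\varphi^{\downarrow}:\mathbb{R}\to\mathbb{R}$ convex non-increasing. For $\varepsilon>0$ let $\mathcal{A}_{1;\varepsilon}(\theta)=\{1\le i\le k_1 \mid \psi_{1,i}(\theta)\ge g(\theta)-\varepsilon\}$ and $\mathcal{A}_{2;\varepsilon}(\theta)=\{1\le i\le k_2\mid \psi_{2,i}(\theta)\ge h(\theta)-\varepsilon\}$. For $\bar\theta\in\Theta$ and an index pair $(i_1,i_2)$ define the convex set $\mathcal{Z}_{(i_1,i_2)}(\bar\theta)$ of all $z=(\theta,r,s)\in\Theta\times\mathbb{R}\times\mathbb{R}$ such that $$\psi_{1,j}(\theta)-\psi_{2,i_2}(\bar\theta)-\nabla\psi_{2,i_2}(\bar\theta)^T(\theta-\bar\theta)\le r,\quad 1\le j\le k_1,$$ $$\psi_{1,i_1}(\bar\theta)+\nabla\psi_{1,i_1}(\bar\theta)^T(\theta-\bar\theta)-\psi_{2,j}(\theta)\ge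 s,\quad 1\le j\le k_2.$$ For $c>0$, $z=(\theta,r,s)$ and $z^\nu=(\theta^\nu,r_\nu,s_\nu)$ let $\widehat\Psi_c(z,z^\nu)=\varphi^{\uparrow}(r)+\varphi^{\downarrow}(s)+\frac{c}{2}\|z-z^\nu\|^2$ (Euclidean norm). Nonmonotone MM algorithm. Initialization: given $c>0$, $\varepsilon>0$, $\theta^0\in\Theta$, set $r_0=s_0=\psi(\theta^0)$, $z^0=(\theta^0,r_0,s_0)$, $\nu=0$. Step 1: for every pair $(i_1,i_2)\in\mathcal{A}_{1;\varepsilon}(\theta^\nu)\times\mathcal{A}_{2;\varepsilon}(\theta^\nu)$ compute $z^{\nu+\frac12;i_1,i_2}$, the (unique) minimizer of $\widehat\Psi_c(\cdot,z^\nu)$ over $\mathcal{Z}_{(i_1,i_2)}(\theta^\nu)$. Step 2: set $z^{\nu+1}=z^{\nu+\frac12;\hat i_1,\hat i_2}$, where $(\hat i_1,\hat i_2)$ minimizes $\widehat\Psi_c(z^{\nu+\frac12;i_1,i_2},z^\nu)$ over all pairs $(i_1,i_2)\in\mathcal{A}_{1;\varepsilon}(\theta^\nu)\times\mathcal{A}_{2;\varepsilon}(\theta^\nu)$. Step 3: replace $\nu$ by $\nu+1$ and return to Step 1 (no stopping rule is applied here). A point $\bar\theta\in\Theta$ is d(irectional)-stationary for minimizing $\Psi$ over $\Theta$ if the one-sided directional derivative $\Psi'(\bar\theta;\theta-\bar\theta)=\lim_{\delta\downarrow0}\frac{\Psi(\bar\theta+\delta(\theta-\bar\theta))-\Psi(\bar\theta)}{\delta}$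 satisfies $\Psi'(\bar\theta;\theta-\bar\theta)\ge0$ for all $\theta\in\Theta$. *)

(* Defs.v *)
From HB Require Import structures.
From mathcomp Require Import all_boot all_order all_algebra.
From mathcomp Require Import all_classical all_reals all_analysis.

Set Implicit Arguments.
Unset Strict Implicit.
Unset Printing Implicit Defensive.

Import Order.TTheory GRing.Theory Num.Theory.
Import numFieldNormedType.Exports.

Local Open Scope classical_set_scope.
Local Open Scope ring_scope.

Definition dot (R : realType) (m : nat) (u v : 'rV[R]_m) : R :=
  \sum_(i < m) u 0 i * v 0 i.

Definition grad (R : realType) (m : nat) (f : 'rV[R]_m -> R)
    (x : 'rV[R]_m) : 'rV[R]_m :=
  \row_(j < m) 'D_(delta_mx 0 j) f x.

Definition is_minimizer (R : realType) (T : Type) (A : set T) (F : T -> R)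
    (x : T) : Prop :=
  A x /\ forall y, A y -> F x <= F y.

(* The limit is required to exist: the library's total [lim] operator would
   return an arbitrary value on a divergent difference quotient. *)
Definition d_stationary (R : realType) (m : nat) (Theta : set 'rV[R]_m)
    (F : 'rV[R]_m -> R) (x : 'rV[R]_m) : Prop :=
  Theta x /\
  forall y, Theta y ->
    exists l : R,
      (F (x + d *: (y - x)) - F x) / d @[d --> 0^'+] --> l /\ 0 <= l.

(* A family indexed by ['I_k.+1] is a nonempty finite family, so the maximum
   may be started from its first member. *)
Definition max_family (R : realType) (m k : nat)
    (f : 'I_k.+1 -> 'rV[R]_m -> R) (x : 'rV[R]_m) : R :=
  \big[Num.max/f ord0 x]_(i < k.+1) f i x.

Definition active (R : realType) (m k : nat) (f : 'I_k.+1 -> 'rV[R]_m -> R)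
    (eps : R) (x : 'rV[R]_m) : set 'I_k.+1 :=
  [set i | max_family f x - eps <= f i x].

Definition psi (R : realType) (m k1 k2 : nat)
    (psi1 : 'I_k1.+1 -> 'rV[R]_m -> R) (psi2 : 'I_k2.+1 -> 'rV[R]_m -> R)
    (x : 'rV[R]_m) : R :=
  max_family psi1 x - max_family psi2 x.

(* z = (theta, r, s) *)
Notation zpoint R m := ('rV[R]_m * R * R)%type.

Definition pt_theta (R : realType) (m : nat) (z : zpoint R m) := z.1.1.
Definition pt_r (R : realType) (m : nat) (z : zpoint R m) := z.1.2.
Definition pt_s (R : realType) (m : nat) (z : zpoint R m) := z.2.

(* Euclidean norm; the library's norms on row vectors and on products are
   sup norms. *)
Definition enorm (R : realType) (m : nat) (z : zpoint R m) : R :=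
  Num.sqrt (dot (pt_theta z) (pt_theta z) + pt_r z ^+ 2 + pt_s z ^+ 2).

Definition feasible (R : realType) (m k1 k2 : nat) (Theta : set 'rV[R]_m)
    (psi1 : 'I_k1.+1 -> 'rV[R]_m -> R) (psi2 : 'I_k2.+1 -> 'rV[R]_m -> R)
    (i1 : 'I_k1.+1) (i2 : 'I_k2.+1) (tbar : 'rV[R]_m) :
    set (zpoint R m) :=
  [set z | [/\ Theta (pt_theta z),
    forall j, psi1 j (pt_theta z) - psi2 i2 tbar
                - dot (grad (psi2 i2) tbar) (pt_theta z - tbar) <= pt_r z
  & forall j, pt_s z <= psi1 i1 tbar
                + dot (grad (psi1 i1) tbar) (pt_theta z - tbar)
                - psi2 j (pt_theta z)]].

Definition Psi_hat (R : realType) (m : nat) (phi_up phi_down : R -> R) (c : R)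
    (z znu : zpoint R m) : R :=
  phi_up (pt_r z) + phi_down (pt_s z) + c / 2 * enorm (z - znu) ^+ 2.

(* [zhalf i1 i2] is meaningful only for eps-active pairs [(i1, i2)]. *)
Definition mm_step (R : realType) (m k1 k2 : nat) (Theta : set 'rV[R]_m)
    (phi_up phi_down : R -> R)
    (psi1 : 'I_k1.+1 -> 'rV[R]_m -> R) (psi2 : 'I_k2.+1 -> 'rV[R]_m -> R)
    (c eps : R) (z znext : zpoint R m) : Prop :=
  exists zhalf : 'I_k1.+1 -> 'I_k2.+1 -> zpoint R m,
    (forall i1 i2, active psi1 eps (pt_theta z) i1 ->
       active psi2 eps (pt_theta z) i2 ->
       is_minimizer (feasible Theta psi1 psi2 i1 i2 (pt_theta z))
         (fun w => Psi_hat phi_up phi_down c w z) (zhalf i1 i2)) /\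
    exists i : 'I_k1.+1 * 'I_k2.+1,
      is_minimizer
        (active psi1 eps (pt_theta z) `*` active psi2 eps (pt_theta z))
        (fun p => Psi_hat phi_up phi_down c (zhalf p.1 p.2) z) i /\
      znext = zhalf i.1 i.2.

Definition mm_sequence (R : realType) (m k1 k2 : nat) (Theta : set 'rV[R]_m)
    (phi_up phi_down : R -> R)
    (psi1 : 'I_k1.+1 -> 'rV[R]_m -> R) (psi2 : 'I_k2.+1 -> 'rV[R]_m -> R)
    (c eps : R) (theta0 : 'rV[R]_m) (z : nat -> zpoint R m) : Prop :=
  [/\ Theta theta0,
      z 0%N = (theta0, psi psi1 psi2 theta0, psi psi1 psi2 theta0)
    & forall nu, mm_step Theta phi_up phi_down psi1 psi2 c eps
                   (z nu) (z nu.+1)].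

(* Main.v *)
(* Every feasible point satisfies r >= psi(theta) >= s, so the merit value
   phi_up(r) + phi_down(s) dominates Psi(theta).  The current iterate is feasible
   for its own subproblem at an exactly active pair, whence the merit values
   decrease by at least (c/2) |z^(nu+1) - z^nu|^2: this gives (b) and (d).
   For (c), let z_oo be an accumulation point and (i1, i2) a pair exactly active at
   theta_oo.  This pair is eps-active at all theta^nu close to theta_oo, and a point
   feasible at theta_oo becomes feasible at such theta^nu after an arbitrarily small
   shift of r and s; hence z_oo minimizes the merit value plus a proximal term, and
   by convexity the merit value itself, over the subproblem at theta_oo.  Choosing
   i1 and i2 to realize the directional derivatives of the two maxima along the
   given direction turns this minimality into Psi'(theta_oo; .) >= 0. *)

Require Import Defs.
From HB Require Import structures.
From mathcomp Require Import all_boot all_order all_algebra.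
From mathcomp Require Import all_classical all_reals all_analysis.
From mathcomp Require Import ring lra.

Set Implicit Arguments.
Unset Strict Implicit.
Unset Printing Implicit Defensive.

Import Order.TTheory GRing.Theory Num.Theory.
Import numFieldNormedType.Exports.

Local Open Scope classical_set_scope.
Local Open Scope ring_scope.

Lemma near_eq_cvg_to (T : Type) (U : nbhsType) (F : set_system T) {FF : Filter F}
    (f g : T -> U) (l : U) :
  {near F, f =1 g} -> f x @[x --> F] --> l -> g x @[x --> F] --> l.
Proof. by move=> fg fl; apply: cvg_trans fl; exact: near_eq_cvg. Qed.

Lemma convex_functionP (R : realType) (E : lmodType R) (f : E -> R) :
  convex_function setT f ->
  forall (t : R) x y, 0 <= t -> t <= 1 ->
    f (x + t *: (y - x)) <= f x + t * (f y - f x).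
Proof.
move=> cf t x y t0 t1.
have h : f (t *: y + (1 - t) *: x) <= t * f y + (1 - t) * f x.
  by apply: (cf (Itv01 t0 t1) y x); rewrite inE.
have -> : x + t *: (y - x) = t *: y + (1 - t) *: x.
  by rewrite scalerBr scalerBl scale1r addrCA addrA.
by move: h; lra.
Qed.

(** * Convex functions on the line *)

Section ConvexReal.
Variables (R : realType) (f : R -> R).
Hypothesis cf : convex_function setT f.

(** The chord inequality is kept free of divisions: degenerate triples are allowed and the slope
    comparisons below become polynomial. *)
Lemma convex_three_points a b c : a <= b -> b <= c ->
  (c - a) * f b <= (c - b) * f a + (b - a) * f c.
Proof.
move=> ab bc; have [ac|ac] := eqVneq a c.
  have -> : b = a by apply/eqP; rewrite eq_le ab ac bc.
  by rewrite ac; lra.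
have ca : 0 < c - a by rewrite subr_gt0 lt_neqAle ac (le_trans ab).
have t0 : 0 <= (b - a) / (c - a) by rewrite divr_ge0 ?subr_ge0 ?(le_trans ab bc).
have t1 : (b - a) / (c - a) <= 1 by rewrite ler_pdivrMr// mul1r lerD2r.
have := convex_functionP cf a c t0 t1.
have -> : a + ((b - a) / (c - a)) *: (c - a) = b.
  rewrite /GRing.scale /=. rewrite divfK ?gt_eqF// addrC subrK. by [].
rewrite -(ler_pM2l ca) => /le_trans; apply.
have -> : (c - a) * (f a + (b - a) / (c - a) * (f c - f a)) =
    (c - b) * f a + (b - a) * f c.
  by field; rewrite gt_eqF.
by [].
Qed.

(** Chord slopes increase from left to right, so on [[t0 - 1, t0 + 1]] they lie between the slope
    [- K2] over [[t0 - 2, t0 - 1]] and the slope [K1] over [[t0 + 1, t0 + 2]]. *)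
Lemma convex_locally_lipschitz t0 : exists K : R, forall x y,
  `|x - t0| <= 1 -> `|y - t0| <= 1 -> `|f x - f y| <= K * `|x - y|.
Proof.
set K1 := f (t0 + 2) - f (t0 + 1); set K2 := f (t0 - 2) - f (t0 - 1).
have up x y : x <= y -> y <= t0 + 1 -> f y - f x <= K1 * (y - x).
  move=> xy y1; have h : 0 < t0 + 2 - y by lra.
  have A := @convex_three_points x y (t0 + 2) xy ltac:(lra).
  have B := @convex_three_points y (t0 + 1) (t0 + 2) y1 ltac:(lra).
  (* [B] bounds the slope from [y] to [t0 + 2] by [K1]; [A] then passes this bound to the slope from
     [x] to [y]. *)
  have C : f (t0 + 2) - f y <= (t0 + 2 - y) * K1 by rewrite /K1; nra.
  have D : 0 <= y - x by rewrite subr_ge0.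
  rewrite -(ler_pM2l h); have := ler_wpM2l D C; nra.
have lo x y : x <= y -> t0 - 1 <= x -> f x - f y <= K2 * (y - x).
  move=> xy x1; have h : 0 < x - (t0 - 2) by lra.
  have A := @convex_three_points (t0 - 2) x y ltac:(lra) xy.
  have B := @convex_three_points (t0 - 2) (t0 - 1) x ltac:(lra) x1.
  have C : f (t0 - 2) - f x <= (x - (t0 - 2)) * K2 by rewrite /K2; nra.
  have D : 0 <= y - x by rewrite subr_ge0.
  rewrite -(ler_pM2l h); have := ler_wpM2l D C; nra.
have main x y : x <= y -> `|x - t0| <= 1 -> `|y - t0| <= 1 ->
    `|f x - f y| <= Num.max K1 K2 * (y - x).
  rewrite !ler_norml => xy /andP[xl xr] /andP[yl yr].
  have D : 0 <= y - x by rewrite subr_ge0.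
  have U := up x y xy ltac:(lra); have L := lo x y xy ltac:(lra).
  have M1 : K1 * (y - x) <= Num.max K1 K2 * (y - x).
    by rewrite ler_wpM2r// le_max lexx.
  have M2 : K2 * (y - x) <= Num.max K1 K2 * (y - x).
    by rewrite ler_wpM2r// le_max lexx orbT.
  by apply/andP; split; lra.
exists (Num.max K1 K2) => x y hx hy; have [xy|/ltW yx] := leP x y.
  by rewrite (distrC x) (ger0_norm (_ : 0 <= y - x)) ?subr_ge0//; apply: main.
by rewrite distrC (ger0_norm (_ : 0 <= x - y)) ?subr_ge0//; apply: main.
Qed.

Lemma convex_continuous : continuous f.
Proof.
move=> t0; have [K HK] := convex_locally_lipschitz t0.
have : K * `|x - t0| @[x --> t0] --> (0 : R).
  have -> : (0 : R) = K * `|t0 - t0| by rewrite subrr normr0 mulr0.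
  apply: cvgMl_tmp; apply: cvg_norm; apply: cvgB; [exact: cvg_id|exact: cvg_cst].
move=> Klim; apply/subr_cvg0; apply/norm_cvg0P.
apply: (squeeze_cvgr _ (cvg_cst 0) Klim).
near=> x; rewrite normr_ge0 /=; apply: HK; last by rewrite subrr normr0 ler01.
by near: x; exists 1 => //= x /ltW; rewrite distrC.
Unshelve. all: by end_near.
Qed.

(** A one-sided chain rule whose limit depends only on the initial slope [u], so different curves
    with that slope can be exchanged. Along the line [t0 + d * u] the quotient is monotone and
    bounded below, hence convergent; any other curve deviates from the line by o(d), which the local
    Lipschitz bound makes negligible. *)
Lemma convex_right_derivative (t0 u : R) : exists L : R, forall p : R -> R,
  (p d - t0) / d @[d --> (0 : R)^'+] --> u ->
  (f (p d) - f t0) / d @[d --> (0 : R)^'+] --> L.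
Proof.
pose q d := (f (t0 + d * u) - f t0) / d.
have qmono d1 d2 : 0 < d1 -> d1 <= d2 -> q d1 <= q d2.
  move=> d10 d12; have d20 : 0 < d2 by exact: lt_le_trans d12.
  rewrite /q ler_pdivrMr// mulrAC -mulrA [_ * (d1 / d2)]mulrC.
  have h0 : 0 <= d1 / d2 by rewrite divr_ge0// ltW.
  have h1 : d1 / d2 <= 1 by rewrite ler_pdivrMr// mul1r.
  have := convex_functionP cf t0 (t0 + d2 * u) h0 h1.
  rewrite /GRing.scale/= [t0 + _ - _]addrC addKr mulrA divfK ?gt_eqF//; lra.
(* The point [t0] lies between [t0 - u] and [t0 + d * u], the latter with weight [(1 + d)^-1]. *)
have qlb d : 0 < d -> f t0 - f (t0 - u) <= q d.
  move=> d0; rewrite /q ler_pdivlMr//.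
  have d1 : 0 < 1 + d by lra.
  have h0 : 0 <= (1 + d)^-1 by rewrite invr_ge0 ltW.
  have h1 : (1 + d)^-1 <= 1 by rewrite invf_le1//; lra.
  have := convex_functionP cf (t0 - u) (t0 + d * u) h0 h1.
  have -> : t0 - u + (1 + d)^-1 *: (t0 + d * u - (t0 - u)) = t0.
    by rewrite /GRing.scale/=; field; rewrite gt_eqF.
  rewrite -(ler_pM2l d1) mulrDr mulrA divff ?gt_eqF//; lra.
have qcvg : cvg (q d @[d --> (0 : R)^'+]).
  apply: nondecreasing_at_right_is_cvgr; near=> a.
    move=> x y; rewrite !in_itv/= => /andP[x0 _] _ xy; exact: qmono.
  exists (f t0 - f (t0 - u)) => _ [x /= + <-]; rewrite in_itv/= => /andP[x0 _].
  exact: qlb.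
exists (lim (q d @[d --> (0 : R)^'+])) => p pu.
have [K HK] := convex_locally_lipschitz t0.
have dlim : d @[d --> (0 : R)^'+] --> (0 : R).
  by apply: cvg_at_right_filter; exact: cvg_id.
have pt : p d - t0 @[d --> (0 : R)^'+] --> (0 : R).
  have h : d * ((p d - t0) / d) @[d --> (0 : R)^'+] --> 0 * u by exact: cvgM.
  rewrite mul0r in h; apply: near_eq_cvg_to h.
  by near=> d; rewrite mulrC divfK// gt_eqF.
have ut : d * u @[d --> (0 : R)^'+] --> (0 : R).
  by rewrite -[X in _ --> X](mul0r u); apply: cvgMr_tmp.
have elim : K * `|(p d - t0) / d - u| @[d --> (0 : R)^'+] --> (0 : R).
  rewrite -[X in _ --> X](_ : K * `|u - u| = 0); last by rewrite subrr normr0 mulr0.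
  by apply: cvgMl_tmp; apply: cvg_norm; apply: cvgB => //; exact: cvg_cst.
suff dlt : (f (p d) - f t0) / d - q d @[d --> (0 : R)^'+] --> (0 : R).
  rewrite -[X in _ --> X]add0r.
  have h : (f (p d) - f t0) / d - q d + q d @[d --> (0 : R)^'+] -->
      0 + lim (q d @[d --> (0 : R)^'+]) by exact: cvgD.
  by apply: near_eq_cvg_to h; near=> d; rewrite subrK.
apply/norm_cvg0P; apply: (squeeze_cvgr _ (cvg_cst 0) elim).
near=> d; rewrite normr_ge0 /=.
have d0 : 0 < d by [].
have -> : (f (p d) - f t0) / d - q d = (f (p d) - f (t0 + d * u)) / d.
  by rewrite /q -mulrBl; congr (_ / _); ring.
rewrite normrM [`|d^-1|]gtr0_norm ?invr_gt0// ler_pdivrMr//.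
have -> : K * `|(p d - t0) / d - u| * d = K * `|p d - (t0 + d * u)|.
  rewrite [in RHS](_ : p d - _ = ((p d - t0) / d - u) * d); last first.
    by rewrite mulrBl divfK ?gt_eqF//; ring.
  by rewrite normrM (gtr0_norm d0) mulrA.
(* The Lipschitz bound is valid only within distance 1 of [t0], which both points reach for small
   [d]. *)
apply: HK.
  by near: d; move: pt => /cvgr_norm_le; apply; rewrite normr0.
by rewrite addrC addKr; near: d; move: ut => /cvgr_norm_le; apply; rewrite normr0.
Unshelve. all: by end_near.
Qed.

End ConvexReal.

(** * Tangents and finite maxima *)

Lemma dot_grad (R : realType) (m : nat) (f : 'rV[R]_m -> R) (x v : 'rV[R]_m) :
  differentiable f x -> dot (grad f x) v = 'D_v f x.
Proof.
move=> df; rewrite deriveE// {2}[v]row_sum_delta linear_sum; apply: eq_bigr => i _.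
by rewrite linearZ mxE deriveE// mulrC.
Qed.

Lemma differentiable_right_quotient (R : realType) (V : normedModType R)
    (f : V -> R) (x v : V) : differentiable f x ->
  (f (x + d *: v) - f x) / d @[d --> (0 : R)^'+] --> 'D_v f x.
Proof.
move=> /(@diff_derivable _ _ _ _ _ v) dv.
have h : (0 : R)^'+ `=>` (0 : R)^'.
  by apply: within_subset => t /= t0; rewrite gt_eqF.
have := cvg_trans (cvg_app _ h) dv.
apply: near_eq_cvg_to; near=> d.
by rewrite /= /GRing.scale /= mulrC [d *: v + x]addrC.
Unshelve. all: by end_near.
Qed.

Section TangentSupport.
Variables (R : realType) (V : normedModType R) (f : V -> R).
Hypotheses (cf : convex_function setT f) (df : forall x, differentiable f x).

(** By convexity the difference quotients towards [y] are at most [f y - f x] for steps in [(0, 1]];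
    the bound survives in the limit. *)
Lemma convex_above_tangent x y : f x + 'D_(y - x) f x <= f y.
Proof.
rewrite addrC -lerBrDr.
apply: (cvgr_to_le (differentiable_right_quotient (v := y - x) (df x))).
near=> d; have d0 : 0 < d by [].
have d1 : d <= 1 by near: d; exact: nbhs_right_le.
by rewrite ler_pdivrMr// mulrC lerBlDl; apply: convex_functionP => //; exact: ltW.
Unshelve. all: by end_near.
Qed.

(* No continuity of the derivative is assumed: the slope at [x] in the direction
   [x - y] is dominated by a difference quotient, which is continuous in [x]. *)
Lemma tangent_lower_semicontinuous (x0 y : V) (eta : R) : 0 < eta ->
  \forall x \near x0, f x0 + 'D_(y - x0) f x0 - eta <= f x + 'D_(y - x) f x.
Proof.
move=> eta0; have DN x : 'D_(y - x) f x = - 'D_(x - y) f x.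
  by rewrite !deriveE// -linearN opprB.
(* The step [t] is fixed here, with quotient within [eta] of the slope at [x0]; only then does [x]
   vary. *)
have [t t0 ht] : exists2 t, 0 < t &
    (f (x0 + t *: (x0 - y)) - f x0) / t < 'D_(x0 - y) f x0 + eta.
  have /cvgr_lt := differentiable_right_quotient (v := x0 - y) (df x0).
  move=> /(_ ('D_(x0 - y) f x0 + eta)).
  rewrite ltrDl => /(_ eta0) H; near (0 : R)^'+ => t; exists t => //.
  by near: t.
have fc : continuous f by move=> x; exact: differentiable_continuous.
have ct : f x - (f (x + t *: (x - y)) - f x) / t @[x --> x0] -->
          f x0 - (f (x0 + t *: (x0 - y)) - f x0) / t.
  apply: cvgB; first exact: fc.
  apply: cvgMr_tmp; apply: cvgB; last exact: fc.
  apply: (@cvg_comp _ _ _ (fun x => x + t *: (x - y)) f); last exact: fc.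
  apply: cvgD; [exact: cvg_id|apply: cvgZl_tmp].
  by apply: cvgB; [exact: cvg_id|exact: cvg_cst].
have /(cvgr_gt _ ct) H : f x0 + 'D_(y - x0) f x0 - eta <
    f x0 - (f (x0 + t *: (x0 - y)) - f x0) / t by rewrite DN; lra.
near=> x; apply: (@le_trans _ _ (f x - (f (x + t *: (x - y)) - f x) / t)).
  by apply: ltW; near: x.
rewrite DN lerD2l lerN2 ler_pdivlMr// mulrC.
have := convex_above_tangent x (x + t *: (x - y)).
by rewrite [x + _ - x]addrC addKr lerBrDl !deriveE// linearZ.
Unshelve. all: by end_near.
Qed.

End TangentSupport.

Section MaxFamily.
Variables (R : realType) (m k : nat) (f : 'I_k.+1 -> 'rV[R]_m -> R).

Lemma max_family_ge i x : f i x <= max_family f x.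
Proof. exact: le_bigmax. Qed.

Lemma max_family_le x M : (forall i, f i x <= M) -> max_family f x <= M.
Proof. by move=> h; apply: bigmax_le. Qed.

Lemma max_family_attained x : exists i, max_family f x = f i x.
Proof.
have [i _ imax] := @arg_maxP _ _ _ ord0 xpredT (f ^~ x) isT.
exists i; apply/eqP; rewrite eq_le max_family_ge andbT.
by apply: max_family_le => j; exact: imax.
Qed.

Hypothesis df : forall i x, differentiable (f i) x.

Lemma max_family_continuous : continuous (max_family f).
Proof.
have fc i : continuous (f i) by move=> x; exact: differentiable_continuous.
suff h (s : seq 'I_k.+1) :
    continuous (fun x => \big[Num.max/f ord0 x]_(i <- s) f i x) by exact: h.
elim: s => [|i s IH] x.
  by under eq_fun do rewrite big_nil; exact: fc.
under eq_fun do rewrite big_cons.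
exact: (continuous_max (fc i x) (IH x)).
Qed.

(** The gap between the maximum and [f i] is continuous and vanishes at [x0]. The tolerance [eps]
    thus lets an index chosen at an accumulation point serve at nearby iterates. *)
Lemma max_family_near_active i x0 eps : 0 < eps -> max_family f x0 = f i x0 ->
  \forall x \near x0, active f eps x i.
Proof.
move=> eps0 Ei.
have fc : {for x0, continuous (fun x => max_family f x - f i x)}.
  apply: continuousB; first exact: max_family_continuous.
  exact: differentiable_continuous.
have : max_family f x0 - f i x0 < eps by rewrite Ei subrr.
move=> /(cvgr_lt _ fc); apply: filterS => x; rewrite /active /=; lra.
Qed.

(** Danskin's formula for a finite maximum: the directional derivative is the largest slope among
    the members attaining the maximum. The index is returned because the stationarity argument
    linearizes exactly that member. *)
Lemma max_family_right_quotient (x v : 'rV[R]_m) :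
  exists2 i, max_family f x = f i x &
    (max_family f (x + d *: v) - max_family f x) / d @[d --> (0 : R)^'+] -->
    'D_v (f i) x.
Proof.
have [i0 /eqP Ei0] := max_family_attained x.
have [i /eqP Ei imax] := @arg_maxP _ _ _ i0
  (fun i => max_family f x == f i x) (fun i => 'D_v (f i) x) Ei0.
exists i => //; apply/cvgrPdist_le => e e0.
have dlim : d @[d --> (0 : R)^'+] --> (0 : R).
  by apply: cvg_at_right_filter; exact: cvg_id.
(* Members attaining the maximum obey this bound by the choice of [i]; for the others the positive
   gap at [x] absorbs all increments, which tend to 0. *)
have up j : \forall d \near (0 : R)^'+,
    f j (x + d *: v) <= max_family f x + d * ('D_v (f i) x + e).
  have [/eqP Ej|Ej] := boolP (max_family f x == f j x).
    have ij : 'D_v (f j) x < 'D_v (f i) x + e.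
      by rewrite (@le_lt_trans _ _ ('D_v (f i) x))// ?ltrDl//; exact/imax/eqP.
    have H : \forall d \near (0 : R)^'+,
        (f j (x + d *: v) - f j x) / d < 'D_v (f i) x + e.
      exact: cvgr_lt (differentiable_right_quotient (v := v) (df j x)) _ ij.
    near=> d; have d0 : 0 < d by [].
    rewrite Ej -lerBlDl mulrC -ler_pdivrMr//.
    by apply: ltW; near: d.
  have lj : f j x < max_family f x by rewrite lt_neqAle eq_sym Ej max_family_ge.
  have c1 : d * ('D_v (f i) x + e) @[d --> (0 : R)^'+] --> (0 : R).
    by rewrite -[X in _ --> X](mul0r ('D_v (f i) x + e)); apply: cvgMr_tmp.
  have c2 : d * ((f j (x + d *: v) - f j x) / d) @[d --> (0 : R)^'+] --> (0 : R).
    rewrite -[X in _ --> X](mul0r ('D_v (f j) x)); apply: cvgM => //.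
    exact: differentiable_right_quotient.
  have c3 : d * ((f j (x + d *: v) - f j x) / d) - d * ('D_v (f i) x + e)
      @[d --> (0 : R)^'+] --> (0 : R).
    by rewrite -[X in _ --> X](subrr 0); apply: cvgB.
  have lj0 : 0 < max_family f x - f j x by rewrite subr_gt0.
  near=> d; have d0 : 0 < d by [].
  have : d * ((f j (x + d *: v) - f j x) / d) - d * ('D_v (f i) x + e) <
      max_family f x - f j x.
    by near: d; exact: (cvgr_lt _ c3).
  rewrite mulrCA divff ?gt_eqF// mulr1; lra.
have upall : \forall d \near (0 : R)^'+, forall j,
    f j (x + d *: v) <= max_family f x + d * ('D_v (f i) x + e).
  exact: filter_forall.
have lo : \forall d \near (0 : R)^'+,
    'D_v (f i) x - e < (f i (x + d *: v) - f i x) / d.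
  apply: cvgr_gt (differentiable_right_quotient (v := v) (df i x)) _ _.
  by rewrite ltrBlDr ltrDl.
near=> d; have d0 : 0 < d by [].
have U : (max_family f (x + d *: v) - max_family f x) / d <= 'D_v (f i) x + e.
  rewrite ler_pdivrMr// lerBlDl mulrC; apply: max_family_le.
  by near: d.
have L : 'D_v (f i) x - e < (max_family f (x + d *: v) - max_family f x) / d.
  apply: (@lt_le_trans _ _ ((f i (x + d *: v) - f i x) / d)).
    by near: d.
  by rewrite ler_pM2r ?invr_gt0// -Ei lerD2r max_family_ge.
rewrite ler_distlC; apply/andP; split; lra.
Unshelve. all: by end_near.
Qed.

End MaxFamily.

(** * The MM algorithm *)

Lemma dot_affine (R : realType) (m : nat) (g p q t : 'rV[R]_m) (a : R) :
  dot g (p + a *: (q - p) - t) =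
  dot g (p - t) + a * (dot g (q - t) - dot g (p - t)).
Proof.
rewrite /dot -sumrB mulr_sumr -big_split; apply: eq_bigr => i _ /=.
by rewrite !mxE; ring.
Qed.

Lemma dotZr (R : realType) (m : nat) (g v : 'rV[R]_m) (a : R) :
  dot g (a *: v) = a * dot g v.
Proof. by rewrite /dot mulr_sumr; apply: eq_bigr => i _; rewrite mxE mulrCA. Qed.

(** * The squared Euclidean norm on triples, coordinate projections and cluster points *)

Lemma enorm_sqrE (R : realType) (m : nat) (z : zpoint R m) :
  enorm z ^+ 2 = dot (pt_theta z) (pt_theta z) + pt_r z ^+ 2 + pt_s z ^+ 2.
Proof.
rewrite /enorm sqr_sqrtr// !addr_ge0 ?sqr_ge0//.
by apply: sumr_ge0 => i _; rewrite -expr2 sqr_ge0.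
Qed.

Lemma enorm_sqrZ (R : realType) (m : nat) (z : zpoint R m) (a : R) :
  enorm (a *: z) ^+ 2 = a ^+ 2 * enorm z ^+ 2.
Proof.
rewrite !enorm_sqrE !mulrDr /dot mulr_sumr.
rewrite -!exprMn; congr (_ + _ + _); apply: eq_bigr => i _.
by rewrite mxE; ring.
Qed.

Lemma enorm0 (R : realType) (m : nat) : enorm (0 : zpoint R m) = 0.
Proof.
apply/eqP; rewrite -sqrf_eq0 -(scale0r 0) enorm_sqrZ expr0n mul0r//.
Qed.

Lemma pt_theta_continuous (R : realType) (m : nat) :
  continuous (@pt_theta R m).
Proof. by move=> z; apply: cvg_comp; [exact: cvg_fst|exact: cvg_fst]. Qed.

Lemma pt_r_continuous (R : realType) (m : nat) : continuous (@pt_r R m).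
Proof. by move=> z; apply: cvg_comp; [exact: cvg_fst|exact: cvg_snd]. Qed.

Lemma pt_s_continuous (R : realType) (m : nat) : continuous (@pt_s R m).
Proof. by move=> z; exact: cvg_snd. Qed.

Lemma enorm_sqr_continuous (R : realType) (m : nat) :
  continuous (fun z : zpoint R m => enorm z ^+ 2).
Proof.
rewrite (_ : (fun z => _) = (fun z : zpoint R m =>
  dot (pt_theta z) (pt_theta z) + pt_r z * pt_r z + pt_s z * pt_s z)); last first.
  by apply/funext => z; rewrite enorm_sqrE !expr2.
move=> z; apply: cvgD; last by apply: cvgM; exact: pt_s_continuous.
apply: cvgD; last by apply: cvgM; exact: pt_r_continuous.
rewrite /dot; apply: cvg_big => [|i _]; first exact: add_continuous.
have ci : (fun w : zpoint R m => pt_theta w 0 i) @ z --> pt_theta z 0 i.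
  apply: (@cvg_comp _ _ _ (@pt_theta R m) (fun t => t 0 i)).
    exact: pt_theta_continuous.
  exact: coord_continuous.
exact: cvgM.
Qed.

Lemma cluster_frequently (T : topologicalType) (u : nat -> T) (p : T)
    (A : set T) :
  cluster (u @ \oo) p -> nbhs p A -> forall N, exists2 n, (N <= n)%N & A (u n).
Proof.
move=> clp nA N.
have uN : (u @ \oo) [set u n | n in [set n | (N <= n)%N]].
  by exists N => // n /= Nn; exists n.
by have [_ [[n Nn <-] An]] := clp _ _ uN nA; exists n.
Qed.

(** * Geometry of the convex subproblems *)

Section Feasible.
Variables (R : realType) (m k1 k2 : nat) (Theta : set 'rV[R]_m).
Variables (psi1 : 'I_k1.+1 -> 'rV[R]_m -> R) (psi2 : 'I_k2.+1 -> 'rV[R]_m -> R).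
Hypothesis Theta_convex : convex_set Theta.
Hypothesis psi1_convex : forall i, convex_function setT (psi1 i).
Hypothesis psi1_differentiable : forall i x, differentiable (psi1 i) x.
Hypothesis psi2_convex : forall i, convex_function setT (psi2 i).
Hypothesis psi2_differentiable : forall i x, differentiable (psi2 i) x.

Lemma convex_segment x y (a : R) : Theta x -> Theta y -> 0 <= a -> a <= 1 ->
  Theta (x + a *: (y - x)).
Proof.
move=> Tx Ty a0 a1.
have : Theta (a *: y + (1 - a) *: x).
  by apply: set_mem; apply: (Theta_convex (Itv01 a0 a1)); rewrite inE.
by rewrite scalerBr scalerBl scale1r addrCA addrA.
Qed.

(** The tangent of [psi2 i2] lies below [psi2 i2], hence below the second maximum, so the
    constraints on [r] overestimate the difference of maxima; the tangent of [psi1 i1] acts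
    symmetrically on [s]. *)
Lemma feasible_psi_bounds i1 i2 t (w : zpoint R m) :
  feasible Theta psi1 psi2 i1 i2 t w ->
  [/\ Theta (pt_theta w), psi psi1 psi2 (pt_theta w) <= pt_r w
    & pt_s w <= psi psi1 psi2 (pt_theta w)].
Proof.
move=> [Tw hr hs]; split => //; rewrite /psi.
  rewrite lerBlDr; apply: max_family_le => j; have := hr j.
  have := convex_above_tangent (psi2_convex i2) (psi2_differentiable i2) t
    (pt_theta w).
  by rewrite dot_grad//; have := max_family_ge psi2 i2 (pt_theta w); lra.
rewrite lerBrDr addrC -lerBrDr; apply: max_family_le => j; have := hs j.
have := convex_above_tangent (psi1_convex i1) (psi1_differentiable i1) t
  (pt_theta w).
by rewrite dot_grad//; have := max_family_ge psi1 i1 (pt_theta w); lra.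
Qed.

(** At the base point the gradient terms vanish, and exact activity turns the constraints into the
    two assumed bounds. *)
Lemma feasible_current i1 i2 (w : zpoint R m) :
  max_family psi1 (pt_theta w) = psi1 i1 (pt_theta w) ->
  max_family psi2 (pt_theta w) = psi2 i2 (pt_theta w) ->
  Theta (pt_theta w) -> psi psi1 psi2 (pt_theta w) <= pt_r w ->
  pt_s w <= psi psi1 psi2 (pt_theta w) ->
  feasible Theta psi1 psi2 i1 i2 (pt_theta w) w.
Proof.
rewrite /psi => E1 E2 Tw hr hs; split => // j; rewrite subrr.
  rewrite -(scale0r 0) dotZr; have := max_family_ge psi1 j (pt_theta w); lra.
rewrite -(scale0r 0) dotZr; have := max_family_ge psi2 j (pt_theta w); lra.
Qed.

(** Each constraint bounds a convex function of [theta] plus an affine one by a linear function of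
    [r] or [s]. *)
Lemma feasible_convex i1 i2 t (p q : zpoint R m) (a : R) :
  feasible Theta psi1 psi2 i1 i2 t p -> feasible Theta psi1 psi2 i1 i2 t q ->
  0 <= a -> a <= 1 -> feasible Theta psi1 psi2 i1 i2 t (p + a *: (q - p)).
Proof.
move=> [Tp pr ps] [Tq qr qs] a0 a1; split.
- exact: convex_segment.
- move=> j; have -> : pt_r (p + a *: (q - p)) =
    pt_r p + a * (pt_r q - pt_r p) by [].
  have -> : pt_theta (p + a *: (q - p)) =
    pt_theta p + a *: (pt_theta q - pt_theta p) by [].
  have := convex_functionP (psi1_convex j) (pt_theta p) (pt_theta q) a0 a1.
  rewrite dot_affine; have := pr j; have := qr j; nra.
- move=> j; have -> : pt_s (p + a *: (q - p)) =
    pt_s p + a * (pt_s q - pt_s p) by [].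
  have -> : pt_theta (p + a *: (q - p)) =
    pt_theta p + a *: (pt_theta q - pt_theta p) by [].
  have := convex_functionP (psi2_convex j) (pt_theta p) (pt_theta q) a0 a1.
  rewrite dot_affine; have := ps j; have := qs j; nra.
Qed.

End Feasible.

(** * Descent along the generated sequence *)

Section Algorithm.
Variables (R : realType) (m k1 k2 : nat).
Variables (Theta : set 'rV[R]_m) (phi_up phi_down : R -> R).
Variables (psi1 : 'I_k1.+1 -> 'rV[R]_m -> R) (psi2 : 'I_k2.+1 -> 'rV[R]_m -> R).
Variables (c eps : R) (theta0 : 'rV[R]_m) (z : nat -> zpoint R m).
Hypothesis Theta_closed : closed Theta.
Hypothesis Theta_convex : convex_set Theta.
Hypothesis phi_up_convex : convex_function setT phi_up.
Hypothesis phi_up_nondecreasing : {homo phi_up : x y / x <= y}.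
Hypothesis phi_down_convex : convex_function setT phi_down.
Hypothesis phi_down_nonincreasing : {homo phi_down : x y /~ x <= y}.
Hypothesis psi1_convex : forall i, convex_function setT (psi1 i).
Hypothesis psi1_differentiable : forall i x, differentiable (psi1 i) x.
Hypothesis psi2_convex : forall i, convex_function setT (psi2 i).
Hypothesis psi2_differentiable : forall i x, differentiable (psi2 i) x.
Hypotheses (c_gt0 : 0 < c) (eps_gt0 : 0 < eps).
Hypothesis z_generated :
  mm_sequence Theta phi_up phi_down psi1 psi2 c eps theta0 z.

(** The subproblem objective without its proximal term; this majorant of the composite objective is
    the quantity shown to decrease. *)
Let merit (w : zpoint R m) := phi_up (pt_r w) + phi_down (pt_s w).
Let psi12 := psi psi1 psi2.

(** Two minimalities are chained: the selected pair beats [(i1, i2)], whose candidate beats every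
    feasible [w]. *)
Lemma mm_step_le nu i1 i2 w :
  active psi1 eps (pt_theta (z nu)) i1 ->
  active psi2 eps (pt_theta (z nu)) i2 ->
  feasible Theta psi1 psi2 i1 i2 (pt_theta (z nu)) w ->
  merit (z nu.+1) + c / 2 * enorm (z nu.+1 - z nu) ^+ 2
    <= merit w + c / 2 * enorm (w - z nu) ^+ 2.
Proof.
move=> a1 a2 fw; have [_ _ /(_ nu)[zh [zhmin [i [[_ imin] ->]]]]] := z_generated.
apply: (le_trans (imin (i1, i2) _)); first by split.
by have [_] := zhmin i1 i2 a1 a2; apply.
Qed.

(** The initialization gives equalities; every later iterate is feasible for the subproblem that
    produced it. *)
Lemma mm_sequence_bounds nu :
  [/\ Theta (pt_theta (z nu)), psi12 (pt_theta (z nu)) <= pt_r (z nu)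
    & pt_s (z nu) <= psi12 (pt_theta (z nu))].
Proof.
have [T0 z0 step] := z_generated.
case: nu => [|nu]; first by rewrite z0.
have [zh [zhmin [i [[[a1 a2] _] ->]]]] := step nu.
have [/feasible_psi_bounds + _] := zhmin _ _ a1 a2.
exact.
Qed.

Lemma merit_ge (w : zpoint R m) t : t <= pt_r w -> pt_s w <= t ->
  phi_up t + phi_down t <= merit w.
Proof.
by move=> tr st; apply: lerD; [exact: phi_up_nondecreasing|exact: phi_down_nonincreasing].
Qed.

Lemma active_of_max (k : nat) (f : 'I_k.+1 -> 'rV[R]_m -> R) i x :
  max_family f x = f i x -> active f eps x i.
Proof. by rewrite /active /= => ->; rewrite gerBl ltW. Qed.

(** The step inequality is applied to the current iterate itself, at an exactly active pair, where
    the proximal term is zero. *)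
Lemma mm_descent nu :
  merit (z nu.+1) + c / 2 * enorm (z nu.+1 - z nu) ^+ 2 <= merit (z nu).
Proof.
have [T hr hs] := mm_sequence_bounds nu.
have [i1 E1] := max_family_attained psi1 (pt_theta (z nu)).
have [i2 E2] := max_family_attained psi2 (pt_theta (z nu)).
have := mm_step_le (active_of_max E1) (active_of_max E2)
  (feasible_current E1 E2 T hr hs).
by rewrite subrr enorm0 expr0n mulr0 addr0.
Qed.

Lemma mm_values_nonincreasing : {homo merit \o z : n p / (n <= p)%N >-> p <= n}.
Proof.
apply/nonincreasing_seqP => n /=; apply: le_trans (mm_descent n).
by rewrite lerDl mulr_ge0 ?sqr_ge0// divr_ge0// ltW.
Qed.

(** Merit values decrease to a limit, so their consecutive differences, which dominate the squared
    steps up to the factor [c / 2], tend to 0. *)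
Lemma mm_steps_vanish (M : R) : (forall n, M <= merit (z n)) ->
  enorm (z nu.+1 - z nu) @[nu --> \oo] --> (0 : R).
Proof.
move=> hM.
have merit_cvg : cvgn (merit \o z).
  apply: nonincreasing_is_cvgn; first exact: mm_values_nonincreasing.
  by exists M => _ [n _ <-]; exact: hM.
have gap : (merit (z n) - merit (z n.+1)) / (c / 2) @[n --> \oo] --> (0 : R).
  rewrite -[X in _ --> X](mul0r (c / 2)^-1); apply: cvgMr_tmp.
  rewrite -[X in _ --> X](subrr (limn (merit \o z))); apply: cvgB => //.
  by have := merit_cvg; rewrite -(cvg_shiftS (merit \o z)).
have sq : enorm (z nu.+1 - z nu) ^+ 2 @[nu --> \oo] --> (0 : R).
  apply: (squeeze_cvgr _ (cvg_cst 0) gap); near=> n.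
  rewrite sqr_ge0 /= ler_pdivlMr ?divr_gt0// mulrC lerBrDl.
  exact: mm_descent.
rewrite -(sqrtr0 R).
have := cvg_comp _ _ sq (@sqrt_continuous R 0).
apply: near_eq_cvg_to; near=> n => /=.
by rewrite sqrtr_sqr ger0_norm// sqrtr_ge0.
Unshelve. all: by end_near.
Qed.

Lemma merit_continuous : continuous merit.
Proof.
move=> w; apply: cvgD.
  apply: (@cvg_comp _ _ _ (@pt_r R m) phi_up); first exact: pt_r_continuous.
  exact: convex_continuous.
apply: (@cvg_comp _ _ _ (@pt_s R m) phi_down); first exact: pt_s_continuous.
exact: convex_continuous.
Qed.

(** * Accumulation points of the iterates *)

Section ClusterPoint.
Variable zo : zpoint R m.
Hypothesis zo_cluster : cluster (z @ \oo) zo.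

(** Otherwise continuity would give some iterate after [n] a larger merit value than [z n], against
    monotonicity. *)
Lemma cluster_value_le n : merit zo <= merit (z n).
Proof.
rewrite leNgt; apply/negP => lt.
have nb : nbhs zo [set w | merit (z n) < merit w] by exact: (cvgr_gt _ (@merit_continuous zo) _ lt).
have [p np /=] := cluster_frequently zo_cluster nb n.
by rewrite ltNge (mm_values_nonincreasing np).
Qed.

(** All three conditions are closed and hold at every iterate. *)
Lemma cluster_bounds : [/\ Theta (pt_theta zo),
  psi12 (pt_theta zo) <= pt_r zo & pt_s zo <= psi12 (pt_theta zo)].
Proof.
have psi12c : continuous (fun w : zpoint R m => psi12 (pt_theta w)).
  move=> w; apply: (@cvg_comp _ _ _ (@pt_theta R m) psi12).
    exact: pt_theta_continuous.
  rewrite /psi12 /psi.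
  by apply: cvgB; exact: max_family_continuous.
have cl (A : set (zpoint R m)) : open (~` A) -> (forall n, A (z n)) -> A zo.
  move=> oA zA; apply: contrapT => nAzo.
  have [n _] := cluster_frequently zo_cluster (open_nbhs_nbhs (conj oA nAzo)) 0.
  exact.
split.
- apply: (cl [set w | Theta (pt_theta w)]); last first.
    by move=> n; have [] := mm_sequence_bounds n.
  have := @open_comp _ _ (@pt_theta R m) (~` Theta).
  by apply=> [w _|]; [exact: pt_theta_continuous|exact: closed_openC].
- apply: (cl [set w | psi12 (pt_theta w) <= pt_r w]); last first.
    by move=> n; have [] := mm_sequence_bounds n.
  have -> : ~` [set w : zpoint R m | psi12 (pt_theta w) <= pt_r w] =
      (fun w => psi12 (pt_theta w) - pt_r w) @^-1` [set x | 0 < x].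
    by apply/seteqP; split => w /=; rewrite subr_gt0 ltNge => /negP.
  apply: open_comp; last exact: open_gt.
  by move=> w _; apply: cvgB; [exact: psi12c|exact: pt_r_continuous].
- apply: (cl [set w | pt_s w <= psi12 (pt_theta w)]); last first.
    by move=> n; have [] := mm_sequence_bounds n.
  have -> : ~` [set w : zpoint R m | pt_s w <= psi12 (pt_theta w)] =
      (fun w => pt_s w - psi12 (pt_theta w)) @^-1` [set x | 0 < x].
    by apply/seteqP; split => w /=; rewrite subr_gt0 ltNge => /negP.
  apply: open_comp; last exact: open_gt.
  by move=> w _; apply: cvgB; [exact: pt_s_continuous|exact: psi12c].
Qed.

Lemma cluster_minimizes_prox i1 i2 w :
  max_family psi1 (pt_theta zo) = psi1 i1 (pt_theta zo) ->
  max_family psi2 (pt_theta zo) = psi2 i2 (pt_theta zo) ->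
  feasible Theta psi1 psi2 i1 i2 (pt_theta zo) w ->
  merit zo <= merit w + c / 2 * enorm (w - zo) ^+ 2.
Proof.
move=> E1 E2 [Tw wr ws].
(* The slack [e] pays for replacing the tangents at [zo] by those at a nearby iterate, each of which
   drops by at most [e] at [pt_theta w]. *)
pose we (e : R) : zpoint R m := (pt_theta w, pt_r w + e, pt_s w - e).
have relaxed e : 0 < e -> merit zo <= merit (we e) + c / 2 * enorm (we e - zo) ^+ 2.
  move=> e0; rewrite leNgt; apply/negP => lt.
  have Fc : {for zo, continuous
      (fun x : zpoint R m => merit (we e) + c / 2 * enorm (we e - x) ^+ 2)}.
    apply: cvgD; first exact: cvg_cst.
    apply: cvgMl_tmp.
    apply: (@cvg_comp _ _ _ (fun x : zpoint R m => we e - x)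
      (fun x => enorm x ^+ 2)).
      by apply: cvgB; [exact: cvg_cst|exact: cvg_id].
    exact: enorm_sqr_continuous.
  have nF : \forall x \near zo, merit (we e) + c / 2 * enorm (we e - x) ^+ 2 < merit zo.
    exact: (cvgr_lt _ Fc _ lt).
  have near_theta P : (\forall t \near pt_theta zo, P t) ->
      \forall x \near zo, P (pt_theta x).
    exact: pt_theta_continuous.
  have n1 := near_theta _ (max_family_near_active psi1_differentiable eps_gt0 E1).
  have n2 := near_theta _ (max_family_near_active psi2_differentiable eps_gt0 E2).
  have n3 := near_theta _ (tangent_lower_semicontinuous (psi1_convex i1)
    (psi1_differentiable i1) (pt_theta zo) (pt_theta w) e0).
  have n4 := near_theta _ (tangent_lower_semicontinuous (psi2_convex i2)
    (psi2_differentiable i2) (pt_theta zo) (pt_theta w) e0).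
  have [n _ [[[[]]]]] := cluster_frequently zo_cluster
    (filterI (filterI (filterI (filterI nF n1) n2) n3) n4) 0.
  move=> Fn a1 a2 t1 t2.
  have fw : feasible Theta psi1 psi2 i1 i2 (pt_theta (z n)) (we e).
    split=> // j; rewrite /we /pt_theta /pt_r /pt_s /= -/(pt_theta w)
      -/(pt_r w) -/(pt_s w) dot_grad//.
      by have := wr j; rewrite dot_grad//; lra.
    by have := ws j; rewrite dot_grad//; lra.
  (* The contradiction is a cycle: the merit at [zo] is at most that at [z n.+1], hence at most the
     proximal value of [we e] at [z n], which [Fn] places strictly below the merit at [zo]. *)
  have := mm_step_le a1 a2 fw; have := cluster_value_le n.+1.
  have : 0 <= c / 2 * enorm (z n.+1 - z n) ^+ 2.
    by rewrite mulr_ge0 ?sqr_ge0// divr_ge0// ltW.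
  by lra.
have wec : we e @[e --> (0 : R)^'+] --> w.
  have elim : e @[e --> (0 : R)^'+] --> (0 : R).
    by apply: cvg_at_right_filter; exact: cvg_id.
  rewrite (_ : w = (pt_theta w, pt_r w + 0, pt_s w - 0)); last first.
    by rewrite addr0 subr0; case: w {Tw wr ws we relaxed} => -[].
  have h1 : pt_r w + e @[e --> (0 : R)^'+] --> pt_r w + 0.
    by apply: cvgD => //; exact: cvg_cst.
  have h2 : pt_s w - e @[e --> (0 : R)^'+] --> pt_s w - 0.
    by apply: cvgB => //; exact: cvg_cst.
  exact: (cvg_pair (cvg_pair (cvg_cst (pt_theta w)) h1) h2).
have Fc : merit (we e) + c / 2 * enorm (we e - zo) ^+ 2 @[e --> (0 : R)^'+] -->
    merit w + c / 2 * enorm (w - zo) ^+ 2.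
  apply: cvgD; first exact: (cvg_comp _ _ wec (@merit_continuous w)).
  apply: cvgMl_tmp.
  apply: (@cvg_comp _ _ _ (fun e => we e - zo)
    (fun x : zpoint R m => enorm x ^+ 2)).
    by apply: cvgB; [exact: wec|exact: cvg_cst].
  exact: enorm_sqr_continuous.
apply: (cvgr_to_ge Fc); near=> e; exact: relaxed.
Unshelve. all: by end_near.
Qed.

(* The proximal term is of second order along the segment from [zo] to [w]. *)
Lemma cluster_minimizes i1 i2 w :
  max_family psi1 (pt_theta zo) = psi1 i1 (pt_theta zo) ->
  max_family psi2 (pt_theta zo) = psi2 i2 (pt_theta zo) ->
  feasible Theta psi1 psi2 i1 i2 (pt_theta zo) w -> merit zo <= merit w.
Proof.
move=> E1 E2 fw; have [To rho sho] := cluster_bounds.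
set K := c / 2 * enorm (w - zo) ^+ 2.
have seg a : 0 < a -> a <= 1 -> merit zo - a * K <= merit w.
  move=> a0 a1.
  have fa := feasible_convex Theta_convex psi1_convex psi2_convex
    (feasible_current E1 E2 To rho sho) fw (ltW a0) a1.
  have := cluster_minimizes_prox E1 E2 fa.
  rewrite [zo + _ - zo]addrC addKr enorm_sqrZ.
  have -> : c / 2 * (a ^+ 2 * enorm (w - zo) ^+ 2) = a * (a * K).
    by rewrite /K; ring.
  have : merit (zo + a *: (w - zo)) <= merit zo + a * (merit w - merit zo).
    rewrite /merit.
    have hu : phi_up (pt_r (zo + a *: (w - zo))) <=
      phi_up (pt_r zo) + a * (phi_up (pt_r w) - phi_up (pt_r zo)).
      exact: (convex_functionP phi_up_convex _ _ (ltW a0) a1).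
    have hd : phi_down (pt_s (zo + a *: (w - zo))) <=
      phi_down (pt_s zo) + a * (phi_down (pt_s w) - phi_down (pt_s zo)).
      exact: (convex_functionP phi_down_convex _ _ (ltW a0) a1).
    by lra.
  move=> h1 h2; rewrite -(ler_pM2l a0); lra.
have lim : merit zo - a * K @[a --> (0 : R)^'+] --> merit zo.
  rewrite -[X in _ --> X]subr0 -[X in _ --> _ - X](mul0r K).
  apply: cvgB; first exact: cvg_cst.
  by apply: cvgMr_tmp; apply: cvg_at_right_filter; exact: cvg_id.
apply: (cvgr_to_le lim); near=> a; apply: seg => //.
by near: a; exact: nbhs_right_le.
Unshelve. all: by end_near.
Qed.

(** A feasible curve is built over the segment towards [y]. Its [r] and [s] components have the same
    right slope at [t0] as the difference of maxima, so quotients along the curve share the limits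
    [Lu] and [Ld], while minimality of [zo] gives the sign. *)
Lemma cluster_d_stationary (phi : R -> R) :
  (forall t, phi t = phi_up t + phi_down t) ->
  d_stationary Theta (phi \o psi psi1 psi2) (pt_theta zo).
Proof.
move=> phiE; have [To rho sho] := cluster_bounds; split => // y Ty.
set x := pt_theta zo; set v := y - x; set t0 := psi12 x.
have [i1 E1 q1] := max_family_right_quotient psi1_differentiable x v.
have [i2 E2 q2] := max_family_right_quotient psi2_differentiable x v.
set D1 := 'D_v (psi1 i1) x in q1; set D2 := 'D_v (psi2 i2) x in q2.
have [Lu hLu] := convex_right_derivative phi_up_convex t0 (D1 - D2).
have [Ld hLd] := convex_right_derivative phi_down_convex t0 (D1 - D2).
(* These are the smallest [r] and the largest [s] that the constraints at [x] allow over
   [x + d *: v]. *)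
pose r d := max_family psi1 (x + d *: v) - psi2 i2 x - d * D2.
pose s d := psi1 i1 x + d * D1 - max_family psi2 (x + d *: v).
have pq : (psi12 (x + d *: v) - t0) / d @[d --> (0 : R)^'+] --> D1 - D2.
  apply: (near_eq_cvg_to _ (cvgB q1 q2)); near=> d => /=.
  by rewrite -mulrBl /t0 /psi12 /psi; congr (_ / _); ring.
have rq : (r d - t0) / d @[d --> (0 : R)^'+] --> D1 - D2.
  apply: (near_eq_cvg_to _ (cvgB q1 (cvg_cst D2))); near=> d => /=.
  rewrite !fctE /r /t0 /psi12 /psi E2; field.
  by rewrite gt_eqF.
have sq : (s d - t0) / d @[d --> (0 : R)^'+] --> D1 - D2.
  apply: (near_eq_cvg_to _ (cvgB (cvg_cst D1) q2)); near=> d => /=.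
  rewrite !fctE /s /t0 /psi12 /psi E1; field.
  by rewrite gt_eqF.
exists (Lu + Ld); split.
  apply: (near_eq_cvg_to _ (cvgD (hLu _ pq) (hLd _ pq))).
  by near=> d => /=; rewrite -mulrDl !phiE; congr (_ / _); rewrite /t0; ring.
(* The sign is read off along [r] and [s], where feasibility is available, instead of along
   [psi12]. *)
apply: (cvgr_to_ge (cvgD (hLu _ rq) (hLd _ sq))).
near=> d => /=; have d0 : 0 < d by [].
have d1 : d <= 1 by near: d; exact: nbhs_right_le.
rewrite !fctE -mulrDl divr_ge0 ?(ltW d0)//.
have fw : feasible Theta psi1 psi2 i1 i2 x (x + d *: v, r d, s d).
  have dv g : dot g (x + d *: v - x) = d * dot g v.
    by rewrite [x + _ - x]addrC addKr dotZr.
  split; rewrite /pt_theta /pt_r /pt_s /=.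
  - exact: (convex_segment Theta_convex To Ty (ltW d0) d1).
  - move=> j; rewrite dv dot_grad// /r lerD2r lerD2r; exact: max_family_ge.
  - move=> j; rewrite dv dot_grad// /s lerD2l lerN2; exact: max_family_ge.
(* The components of [zo] may differ from [t0]; monotonicity still puts its merit above the value at
   [t0]. *)
have := cluster_minimizes E1 E2 fw; have := merit_ge rho sho.
by rewrite /merit /pt_r /pt_s /= -/x -/t0; lra.
Unshelve. all: by end_near.
Qed.

End ClusterPoint.
End Algorithm.

Theorem proposition4p5 (R : realType) (m k1 k2 : nat)
    (Theta : set 'rV[R]_m) (phi phi_up phi_down : R -> R)
    (psi1 : 'I_k1.+1 -> 'rV[R]_m -> R) (psi2 : 'I_k2.+1 -> 'rV[R]_m -> R)
    (c eps : R) (theta0 : 'rV[R]_m) (z : nat -> zpoint R m)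
    (Theta_closed : closed Theta)
    (Theta_convex : convex_set Theta)
    (phi_convex : convex_function setT phi)
    (phi_up_convex : convex_function setT phi_up)
    (phi_up_nondecreasing : {homo phi_up : x y / x <= y})
    (phi_down_convex : convex_function setT phi_down)
    (phi_down_nonincreasing : {homo phi_down : x y /~ x <= y})
    (phi_decomposition : forall t, phi t = phi_up t + phi_down t)
    (psi1_convex : forall i, convex_function setT (psi1 i))
    (psi1_differentiable : forall i x, differentiable (psi1 i) x)
    (psi2_convex : forall i, convex_function setT (psi2 i))
    (psi2_differentiable : forall i x, differentiable (psi2 i) x)
    (c_gt0 : 0 < c) (eps_gt0 : 0 < eps)
    (Psi_bounded_below : has_lbound ((phi \o psi psi1 psi2) @` Theta))
    (z_generated :
       mm_sequence Theta phi_up phi_down psi1 psi2 c eps theta0 z) :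
  let Psi := phi \o psi psi1 psi2 in
  [/\ (forall nu i1 i2 w,
         active psi1 eps (pt_theta (z nu)) i1 ->
         active psi2 eps (pt_theta (z nu)) i2 ->
         feasible Theta psi1 psi2 i1 i2 (pt_theta (z nu)) w ->
         phi_up (pt_r (z nu.+1)) + phi_down (pt_s (z nu.+1))
           + c / 2 * enorm (z nu.+1 - z nu) ^+ 2
         <= phi_up (pt_r w) + phi_down (pt_s w)
           + c / 2 * enorm (w - z nu) ^+ 2),
      enorm (z nu.+1 - z nu) @[nu --> \oo] --> (0 : R),
      (forall (theta_oo : 'rV[R]_m) (r_oo s_oo : R),
         cluster (z @ \oo) (theta_oo, r_oo, s_oo) ->
         d_stationary Theta Psi theta_oo)
    & bounded_set [set theta | Theta theta /\ Psi theta <= Psi theta0] ->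
      bounded_fun (fun nu => pt_theta (z nu)) /\
      (bounded_set [set t : R | phi t <= Psi theta0] ->
       bounded_fun (fun nu => (pt_r (z nu), pt_s (z nu))))].
Proof.
move=> Psi.
have PsiE x : Psi x = phi_up (psi psi1 psi2 x) + phi_down (psi psi1 psi2 x).
  by rewrite /Psi /= phi_decomposition.
have bounds n := mm_sequence_bounds psi1_convex psi1_differentiable
  psi2_convex psi2_differentiable z_generated n.
pose merit (w : zpoint R m) := phi_up (pt_r w) + phi_down (pt_s w).
have Psi_le_merit n : Psi (pt_theta (z n)) <= merit (z n).
  have [_ hr hs] := bounds n; rewrite PsiE.
  exact: (merit_ge phi_up_nondecreasing phi_down_nonincreasing hr hs).
(* Initially [r = s], both being the value of [psi] at [theta0], so the first merit value is exactly
   [Psi theta0]. *)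
have merit_le_Psi0 n : merit (z n) <= Psi theta0.
  have [_ z0 _] := z_generated.
  apply: (@le_trans _ _ (merit (z 0%N))); last by rewrite /merit z0 PsiE.
  exact: (mm_values_nonincreasing psi1_convex psi1_differentiable
    psi2_convex psi2_differentiable c_gt0 eps_gt0 z_generated (leq0n n)).
split.
- move=> nu i1 i2 w a1 a2 fw; exact: (mm_step_le z_generated a1 a2 fw).
- have [M hM] := Psi_bounded_below.
  apply: (mm_steps_vanish psi1_convex psi1_differentiable psi2_convex
    psi2_differentiable c_gt0 eps_gt0 z_generated (M := M)) => n.
  apply: le_trans (Psi_le_merit n); apply: hM; exists (pt_theta (z n)) => //.
  by have [] := bounds n.
- move=> t r s clz.
  exact: (cluster_d_stationary Theta_closed Theta_convex phi_up_convex
    phi_up_nondecreasing phi_down_convex phi_down_nonincreasing psi1_convex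
    psi1_differentiable psi2_convex psi2_differentiable c_gt0 eps_gt0
    z_generated clz).
- move=> bTheta; split.
    move: bTheta; rewrite /bounded_near /=; apply: filterS => M hM n _.
    apply: hM; split; first by have [] := bounds n.
    exact: le_trans (merit_le_Psi0 n).
  rewrite /bounded_near /=; apply: filterS => M hM n _.
  have [_ hr hs] := bounds n; have sr := le_trans hs hr.
  (* The whole interval from [s] to [r] lies in the sublevel set of [phi]; its two endpoints are
     what is needed. *)
  have phi_le t : t <= pt_r (z n) -> pt_s (z n) <= t -> phi t <= Psi theta0.
    move=> tr st; rewrite phi_decomposition; apply: le_trans (merit_le_Psi0 n).
    exact: (merit_ge phi_up_nondecreasing phi_down_nonincreasing tr st).
  by rewrite prod_normE /= ge_max; apply/andP; split; apply: hM; apply: phi_le.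
Qed.
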